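(* Let $0\le\mu<L<\infty$, $\kappa:=\mu/L\in[0,1)$, let $f_1,f_2\in\mathcal{F}_{\mu,L}(\mathbb{R}^n)$, let $f=f_1-f_2$, and assume that $f^\star:=\inf_{x\in\mathbb{R}^n}f(x)$ is finite (not necessarily attained). Let $N\ge 1$ be an integer, let $\alpha$ satisfy $0\le\alpha\le\min\{1,2\kappa\}$, and let $x^1,\dots,x^{N+1}$ be iterates generated by $N$ iterations of the boosted DCA with boosted step length $\alpha$ applied to $f=f_1-f_2$ from an arbitrary starting point $x^1\in\mathbb{R}^n$. Then, with $g_1^k=\nabla f_1(x^k)$ and $g_2^k=\nabla f_2(x^k)$ (so that $g_1^k-g_2^k=\nabla f(x^k)$), \[ \min_{1\le k\le N+1}\frac{\|\nabla f(x^k)\|^2}{L}=\min_{1\le k\le N+1}\frac{\|g_1^k-g_2^k\|^2}{L}\le\frac{f(x^1)-f^\star}{(1+\kappa\alpha)N+\frac{1}{2(1-\kappa)}}. \]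
   Context: For $\mu\in(-\infty,\infty)$ and $0\le L<\infty$, $\mathcal{F}_{\mu,L}(\mathbb{R}^n)$ denotes the class of functions $h:\mathbb{R}^n\to\mathbb{R}$ such that $x\mapsto h(x)-\frac{\mu}{2}\|x\|^2$ is convex (minimum curvature $\mu$) and $x\mapsto\frac{L}{2}\|x\|^2-h(x)$ is convex (maximum curvature $L$), where $\|\cdot\|$ is the Euclidean norm. For $0\le\mu\le L<\infty$ such functions are convex and differentiable. Boosted DCA (difference-of-convex algorithm) for $f=f_1-f_2$, with starting point $x^1\in\mathbb{R}^n$, number of iterations $N$ and boosted step length $\alpha\in[0,1]$: for $k=1,\dots,N$, (1) take $g_2^k\in\partial f_2(x^k)$ (here $g_2^k=\nabla f_2(x^k)$); (2) take $y^k\in\operatorname{argmin}_{x\in\mathbb{R}^n}\, f_1(x)-\left(f_2(x^k)+\langle g_2^k,x-x^k\rangle\right)$ (a minimizer is assumed to exist at each iteration); (3) set $d^k=y^k-x^k$ and $x^{k+1}=y^k+\alpha d^k$. *)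

(* Defs.v *)
From mathcomp Require Import all_boot all_order all_algebra.
From mathcomp Require Import all_classical all_reals all_analysis.
Import Order.TTheory GRing.Theory Num.Theory.
Import numFieldNormedType.Exports.

Set Implicit Arguments.
Unset Strict Implicit.
Unset Printing Implicit Defensive.

Local Open Scope classical_set_scope.
Local Open Scope ring_scope.

Definition dotv (R : realType) (n : nat) (u v : 'rV[R]_n) : R :=
  \sum_(i < n) u 0 i * v 0 i.

(* The library norm `|x| on row vectors is the sup norm, hence this one. *)
Definition enorm (R : realType) (n : nat) (x : 'rV[R]_n) : R :=
  Num.sqrt (dotv x x).

(* Partial derivatives are total functions in the library; the value is the
   gradient as soon as [f] is differentiable at [x]. *)
Definition grad (R : realType) (n : nat) (f : 'rV[R]_n -> R) (x : 'rV[R]_n) :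
    'rV[R]_n :=
  \row_(i < n) 'D_(delta_mx 0 i) f x.

Definition curvature_class (R : realType) (n : nat) (mu L : R) :
    set ('rV[R]_n -> R) :=
  [set h | convex_function setT (fun x => h x - mu / 2 * enorm x ^+ 2) /\
           convex_function setT (fun x => L / 2 * enorm x ^+ 2 - h x)].

Definition subdifferential (R : realType) (n : nat) (f : 'rV[R]_n -> R)
    (x : 'rV[R]_n) : set 'rV[R]_n :=
  [set g | forall z, f x + dotv g (z - x) <= f z].

Definition argmin (R : realType) (T : Type) (F : T -> R) : set T :=
  [set y | forall z, F y <= F z].

(* Relational, since neither the subgradient nor the minimizer need be unique;
   the step asserts that a minimizer exists. *)
Definition bdca_step (R : realType) (n : nat) (f1 f2 : 'rV[R]_n -> R)
    (alpha : R) (x x' : 'rV[R]_n) : Prop :=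
  exists g2 y : 'rV[R]_n,
    [/\ subdifferential f2 x g2,
        argmin (fun z => f1 z - (f2 x + dotv g2 (z - x))) y
      & x' = y + alpha *: (y - x)].

(* Iterates are numbered from 1; only [x 1], ..., [x N.+1] are constrained. *)
Definition bdca_iterates (R : realType) (n : nat) (f1 f2 : 'rV[R]_n -> R)
    (alpha : R) (N : nat) (x : nat -> 'rV[R]_n) : Prop :=
  forall k : nat, (1 <= k <= N)%N -> bdca_step f1 f2 alpha (x k) (x k.+1).

(* The neutral element [F 1] is one of the terms, so this is the minimum of
   [F 1], ..., [F m] for [1 <= m]. *)
Definition min_upto (R : realType) (m : nat) (F : nat -> R) : R :=
  \big[Num.min/F 1%N]_(1 <= k < m.+1) F k.

(* Main.v *)
(* The interpolation inequality of the curvature class, applied to f1 between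
   x, y and x' and to f2 between x and x', gives lower bounds on f x - f x' for
   one step x, y, x'.  A suitable nonnegative combination of them is
     L (f x - f x') >= (1/2 + kappa alpha) |grad f x|^2 + 1/2 |grad f x'|^2
   up to a weighted sum of squares, whose weights are nonnegative exactly when
   alpha <= 2 kappa.  Telescoping yields the term (1 + kappa alpha) N; the
   remaining 1 / (2 (1 - kappa)) is the gap f x^{N+1} - inf f, estimated by a
   gradient step of length 1 / (L - mu), since f has maximum curvature L - mu. *)

Require Import Defs.
From mathcomp Require Import all_boot all_order all_algebra.
From mathcomp Require Import all_classical all_reals all_analysis.
From mathcomp Require Import ring lra.
Import Order.TTheory GRing.Theory Num.Theory.
Import numFieldNormedType.Exports.

Set Implicit Arguments.
Unset Strict Implicit.

Local Open Scope classical_set_scope.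
Local Open Scope ring_scope.

(** * The Euclidean inner product *)

Section dot_product.
Context (R : realType) (n : nat).
Implicit Types (u v w : 'rV[R]_n) (a : R).

Lemma dotvC u v : dotv u v = dotv v u.
Proof. by apply: eq_bigr => i _; rewrite mulrC. Qed.

Lemma dotvDl u v w : dotv (u + v) w = dotv u w + dotv v w.
Proof. by rewrite -big_split; apply: eq_bigr => i _; rewrite mxE mulrDl. Qed.

Lemma dotvZl a u w : dotv (a *: u) w = a * dotv u w.
Proof. by rewrite mulr_sumr; apply: eq_bigr => i _; rewrite mxE mulrA. Qed.

Lemma dotvNl u w : dotv (- u) w = - dotv u w.
Proof. by rewrite -scaleN1r dotvZl mulN1r. Qed.

Lemma dotvDr u v w : dotv w (u + v) = dotv w u + dotv w v.
Proof. by rewrite dotvC dotvDl !(dotvC _ w). Qed.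

Lemma dotvZr a u w : dotv w (a *: u) = a * dotv w u.
Proof. by rewrite dotvC dotvZl (dotvC _ w). Qed.

Lemma dotvNr u w : dotv w (- u) = - dotv w u.
Proof. by rewrite dotvC dotvNl (dotvC _ w). Qed.

Lemma dotv0l w : dotv 0 w = 0.
Proof. by rewrite -(scale0r w) dotvZl mul0r. Qed.

Lemma dotv0r w : dotv w 0 = 0.
Proof. by rewrite dotvC dotv0l. Qed.

Definition dotvE := (dotvDl, dotvDr, dotvNl, dotvNr, dotvZl, dotvZr).

Lemma dotv_delta u i : dotv u (delta_mx 0 i) = u 0 i.
Proof.
rewrite /dotv (bigD1 i)//= mxE !eqxx mulr1 big1 ?addr0// => j ji.
by rewrite mxE (negbTE ji) andbF mulr0.
Qed.

Lemma dotv_ge0 u : 0 <= dotv u u.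
Proof. by apply: sumr_ge0 => i _; rewrite -expr2 sqr_ge0. Qed.

Lemma dotv_eq0 u : dotv u u = 0 -> u = 0.
Proof.
move/eqP; rewrite psumr_eq0 => [/allP u0|i _]; last by rewrite -expr2 sqr_ge0.
apply/rowP => i; have := u0 i (mem_index_enum i).
by rewrite mulf_eq0 orbb mxE => /eqP.
Qed.

Lemma enorm_sqr u : enorm u ^+ 2 = dotv u u.
Proof. by rewrite sqr_sqrtr// dotv_ge0. Qed.

End dot_product.

(** At [t = a / (1 + |c|)] the linear term beats the quadratic one unless [a = 0]; the added 1 keeps
    the denominator positive. *)
Lemma eq0_le_sqr (R : realType) (a c : R) : (forall t, a * t <= c * t ^+ 2) -> a = 0.
Proof.
move=> h.
have c1 : 0 < 1 + `|c| by rewrite ltr_pwDl.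
have c1' : 1 + `|c| != 0 by rewrite gt_eqF.
have := h (a / (1 + `|c|)).
have -> : a * (a / (1 + `|c|)) = a ^+ 2 * (1 + `|c|) / (1 + `|c|) ^+ 2 by field.
have -> : c * (a / (1 + `|c|)) ^+ 2 = a ^+ 2 * c / (1 + `|c|) ^+ 2 by field.
rewrite ler_pM2r ?invr_gt0 ?exprn_gt0// => h1.
have := ler_norm c; have := sqr_ge0 a => a0 cc.
apply/eqP; rewrite -sqrf_eq0 eq_le a0 andbT; nra.
Qed.

(** Uniqueness of slopes known up to second order, tested along multiples of [g - g']; it serves to
    identify subgradients with gradients. *)
Lemma dotv_le_sqr (R : realType) n (g g' : 'rV[R]_n) (c : R) :
  (forall v, dotv g v <= dotv g' v + c * dotv v v) -> g = g'.
Proof.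
move=> h; apply/eqP; rewrite -subr_eq0; apply/eqP/dotv_eq0.
apply: (@eq0_le_sqr _ _ (c * dotv (g - g') (g - g'))) => t.
have := h (t *: (g - g')); rewrite !dotvE; lra.
Qed.

(** * Subgradients of convex functions *)

Section convex_subgradient.
Context (R : realType).

Lemma convex_functionE (V : lmodType R) (F : V -> R) :
  convex_function setT F -> forall x y t, 0 <= t <= 1 ->
  F (t *: x + (1 - t) *: y) <= t * F x + (1 - t) * F y.
Proof.
move=> cF x y t /andP[t0 t1].
by have := cF (Itv01 t0 t1) x y (in_setT _) (in_setT _); rewrite convRE.
Qed.

Lemma convex_midpoint (V : lmodType R) (F : V -> R) :
  convex_function setT F -> forall x u v,
  2 * F (x + (u + v)) <= F (x + 2 *: u) + F (x + 2 *: v).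
Proof.
move=> cF x u v.
have := convex_functionE cF (x + 2 *: u) (x + 2 *: v) (t := 2^-1).
have -> : 1 - 2^-1 = 2^-1 :> R by lra.
rewrite -scalerDr addrACA -scalerDr (_ : x + x = 2 *: x); last by rewrite scaler_nat.
rewrite -scalerDr scalerA mulVf// scale1r => h.
have := h ltac:(lra); lra.
Qed.

(** Left difference quotients never exceed right ones, so the infimum of the right ones is finite
    and is a slope valid on both sides. *)
Lemma convex_line_subgradient (V : lmodType R) (F : V -> R) (x v : V) :
  convex_function setT F ->
  exists s, forall t, F x + s * t <= F (x + t *: v).
Proof.
move=> cF.
have slope r t : 0 < r -> 0 < t ->
    (F x - F (x - r *: v)) / r <= (F (x + t *: v) - F x) / t.
  move=> r0 t0; rewrite ler_pdivrMr// mulrAC ler_pdivlMr//.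
  have rt : r + t != 0 by rewrite gt_eqF// addr_gt0.
  have rt1 : 0 <= r / (r + t) <= 1.
    apply/andP; split; first by rewrite divr_ge0 ?addr_ge0 ?ltW.
    by rewrite ler_pdivrMr ?addr_gt0//; lra.
  have := convex_functionE cF (x + t *: v) (x - r *: v) rt1.
  have -> : 1 - r / (r + t) = t / (r + t) by field.
  have -> : r / (r + t) *: (x + t *: v) + t / (r + t) *: (x - r *: v) = x.
    rewrite !scalerDr addrACA -scalerDl scalerN !scalerA -scalerBl.
    have -> : r / (r + t) + t / (r + t) = 1 by field.
    have -> : r / (r + t) * t - t / (r + t) * r = 0 by field.
    by rewrite scale1r scale0r addr0.
  have -> : r / (r + t) * F (x + t *: v) + t / (r + t) * F (x - r *: v)
    = (r * F (x + t *: v) + t * F (x - r *: v)) / (r + t) by field.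
  rewrite ler_pdivlMr ?addr_gt0//; lra.
pose E := [set (F (x + t *: v) - F x) / t | t in [set t | 0 < t]].
have E0 : E !=set0 by exists ((F (x + 1 *: v) - F x) / 1); exists 1 => /=.
have lbE r : 0 < r -> lbound E ((F x - F (x - r *: v)) / r).
  by move=> r0 _ [t /= t0 <-]; exact: slope.
exists (inf E) => t.
have [t0|t0|<-] := ltgtP 0 t; last by rewrite mulr0 addr0 scale0r addr0.
- rewrite addrC -lerBrDr -ler_pdivlMr//; apply: ge_inf; last by exists t.
  by exists ((F x - F (x - 1 *: v)) / 1); exact: lbE.
- have nt0 : 0 < - t by rewrite oppr_gt0.
  have := lb_le_inf E0 (lbE _ nt0).
  rewrite ler_pdivrMr// scaleNr opprK; lra.
Qed.

Context (n : nat).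
Implicit Types (F : 'rV[R]_n -> R) (x v g : 'rV[R]_n) (c : R).

(* The slopes along the coordinate axes form a vector g for which F lies below
   its linearization at x up to second order along each axis; by the midpoint
   inequality this persists along every direction.  Applied to -v, convexity
   turns it into the lower bound. *)
Lemma convex_smooth_subgradient F c x :
  convex_function setT F ->
  convex_function setT (fun z => c * dotv z z - F z) ->
  exists g, forall v, F x + dotv g v <= F (x + v).
Proof.
move=> cF cq.
have line i : exists s, forall t, F x + s * t <= F (x + t *: delta_mx 0 i) <=
    F x + s * t + c * t ^+ 2.
  have [s hs] := convex_line_subgradient x (delta_mx 0 i) cF.
  have [r hr] := convex_line_subgradient x (delta_mx 0 i) cq.
  pose e : 'rV[R]_n := delta_mx 0 i.
  have ee : dotv e e = 1 by rewrite dotv_delta mxE !eqxx.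
  (* [s] and [r] are slopes of [F] and of [c |z|^2 - F], so they add up to the slope of
     [c |z|^2]. *)
  have E : s = 2 * c * dotv x e - r.
    apply/eqP; rewrite -subr_eq0; apply/eqP.
    apply: (@eq0_le_sqr _ _ c) => t.
    have := hs t; have := hr t; rewrite !dotvE -/e ee (dotvC e x); lra.
  exists s => t; rewrite hs/=.
  have := hr t; rewrite !dotvE -/e ee (dotvC e x) E; lra.
have [s hs] := choice line.
pose g : 'rV[R]_n := \row_i s i.
(* [K] may depend on [v]; only its independence of [t] matters below. *)
have upper v : exists K, forall t, F (x + t *: v) <= F x + dotv g v * t + K * t ^+ 2.
  rewrite (row_sum_delta v).
  apply: (big_ind (fun w => exists K, forall t,
    F (x + t *: w) <= F x + dotv g w * t + K * t ^+ 2)).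
  - by exists 0 => t; rewrite scaler0 addr0 dotv0r; lra.
  - move=> u w [K hK] [K' hK']; exists (2 * (K + K')) => t.
    have := convex_midpoint cF x (t *: u) (t *: w).
    rewrite !scalerA -scalerDr; have := hK (2 * t); have := hK' (2 * t).
    rewrite dotvDr; lra.
  - move=> i _; exists (c * v 0 i ^+ 2) => t.
    have /andP[_] := hs i (t * v 0 i).
    by rewrite scalerA dotvZr dotv_delta [g 0 i]mxE exprMn; lra.
exists g => v.
have [K hK] := upper (- v).
(* The midpoint inequality turns the upper bound at [x - t *: v] into a lower bound at [x + t *: v],
   which convexity carries to [x + v] with error [K * t]; then [t] is taken small. *)
have sub t : 0 < t <= 1 -> F x + dotv g v - K * t <= F (x + v).
  move=> /andP[t0 t1].
  have := hK t; rewrite dotvNr => h1.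
  have := convex_midpoint cF x ((t / 2) *: v) (- ((t / 2) *: v)).
  rewrite subrr addr0 scalerN !scalerA (_ : 2 * (t / 2) = t); last by field.
  rewrite -scalerN => h2.
  have := convex_functionE cF (x + v) x (t := t).
  rewrite scalerDr addrAC -scalerDl addrC subrKC scale1r addrC => h3.
  have {}h3 := h3 ltac:(lra).
  rewrite -(ler_pM2l t0); lra.
apply/ler_addgt0Pr => e e0.
have K1 : 0 < 1 + `|K| by rewrite ltr_pwDl.
pose t := Num.min 1 (e / (1 + `|K|)).
have t0 : 0 < t by rewrite lt_min ltr01 divr_gt0.
have t1 : t <= 1 by rewrite ge_min lexx.
have te : t * (1 + `|K|) <= e by rewrite -ler_pdivlMr// ge_min lexx orbT.
have := sub t; rewrite t0 t1 => /(_ isT).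
have := ler_norm K; nra.
Qed.

End convex_subgradient.

(** The quadratic error keeps each difference quotient within a multiple of [|t|] of the entry of
    [g], so the limits defining [grad] exist and are not default values. *)
Lemma grad_quadratic (R : realType) n (f : 'rV[R]_n -> R) (x g : 'rV[R]_n) K :
  (forall v, `|f (x + v) - f x - dotv g v| <= K * dotv v v) -> grad f x = g.
Proof.
move=> h; apply/rowP => i; rewrite mxE.
set e := delta_mx _ _; rewrite -[g 0 i](dotv_delta g) -/e.
have ee : dotv e e = 1 by rewrite dotv_delta mxE !eqxx.
apply: cvg_lim => //; apply/cvgrPdist_le => /= eps eps0.
have K1 : 0 < 1 + `|K| by rewrite ltr_pwDl.
near=> t.
have t0 : t != 0 by near: t; exact: nbhs_dnbhs_neq.
have te : `|t| * (1 + `|K|) <= eps.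
  rewrite -ler_pdivlMr//; near: t; apply: dnbhs0_le.
  by rewrite divr_gt0.
have := h (t *: e); rewrite !dotvE ee mulr1 (addrC x).
set y := f (_ + x) => h1.
have -> : dotv g e - t^-1 *: (y - f x : R^o) = - (y - f x - t * dotv g e) / t.
  by rewrite (_ : _ *: _ = t^-1 * (y - f x))//; field.
rewrite mulNr normrN normrM normfV ler_pdivrMr ?normr_gt0//; apply: (le_trans h1).
have := ler_norm (K * (t * t)); rewrite !normrM => h2; apply: (le_trans h2).
have := normr_ge0 t; nra.
Unshelve. all: by end_near. Qed.

(** * Gradient bounds and interpolation in the curvature class *)

Section curvature.
Context (R : realType) (n : nat) (mu L : R) (h : 'rV[R]_n -> R).
Context (hC : curvature_class mu L h).

(** [H] and [q] are convex with sum [c |z|^2], so each limits the growth of the other and both have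
    subgradients at [x], with sum [2 c x]. That of [H] gives the lower bound, that of [q] the upper
    one. *)
Lemma curvature_quadratic_bounds x : exists g, forall v,
  h x + dotv g v + mu / 2 * dotv v v <= h (x + v) <=
  h x + dotv g v + L / 2 * dotv v v.
Proof.
have [cl cu] := hC.
pose c := (L - mu) / 2.
pose H z := h z - mu / 2 * dotv z z.
pose q z := L / 2 * dotv z z - h z.
have cH : convex_function setT H.
  by congr (convex_function _ _) : cl; apply/funext => z; rewrite enorm_sqr.
have cq : convex_function setT q.
  by congr (convex_function _ _) : cu; apply/funext => z; rewrite enorm_sqr.
have cH' : convex_function setT (fun z => c * dotv z z - q z).
  by congr (convex_function _ _) : cH; apply/funext => z; rewrite /H /q /c; lra.
have cq' : convex_function setT (fun z => c * dotv z z - H z).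
  by congr (convex_function _ _) : cq; apply/funext => z; rewrite /H /q /c; lra.
have [g hg] := convex_smooth_subgradient x cH cq'.
have [g' hg'] := convex_smooth_subgradient x cq cH'.
have E : g + g' = (2 * c) *: x.
  apply: (@dotv_le_sqr _ _ _ _ c) => v.
  have := hg v; have := hg' v.
  rewrite /H /q /c !dotvE (dotvC v x); lra.
exists (g + mu *: x) => v.
have := congr1 (fun w => dotv w v) E; have := hg v; have := hg' v.
rewrite /H /q /c !dotvE (dotvC v x) => *; apply/andP; split; lra.
Qed.

Lemma curvature_grad_bounds x v :
  h x + dotv (grad h x) v + mu / 2 * dotv v v <= h (x + v) <=
  h x + dotv (grad h x) v + L / 2 * dotv v v.
Proof.
have [g hg] := curvature_quadratic_bounds x.
rewrite (@grad_quadratic _ _ _ _ g (`|mu| + `|L|))// => w.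
have /andP[] := hg w; have := dotv_ge0 w.
have := ler_norm (- mu); have := ler_norm L; rewrite normrN => *.
have := normr_ge0 mu; have := normr_ge0 L => *.
by rewrite ler_norml; apply/andP; split; nra.
Qed.

Lemma subdifferential_grad x g : subdifferential h x g -> g = grad h x.
Proof.
move=> hg; apply: (@dotv_le_sqr _ _ _ _ (L / 2)) => v.
have /andP[_] := curvature_grad_bounds x v.
have := hg (x + v); rewrite addrAC subrr add0r; lra.
Qed.

(** The lower bound based at [b] and the upper bound based at [a] are compared at the common point
    [a + w]. *)
Lemma curvature_interpolation a b v (kappa := mu / L) (s := grad h a - grad h b) :
  0 < L -> mu < L -> a = b + v ->
  2^-1 * dotv s s + kappa / (2 * (1 - kappa)) * dotv (L *: v - s) (L *: v - s)
  <= L * (h a - h b - dotv (grad h b) v).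
Proof.
move=> L0 muL ab.
have Lmu : L - mu != 0 by rewrite subr_eq0 gt_eqF.
have Ln0 : L != 0 by rewrite gt_eqF.
(* The maximizer of the concave quadratic [mu/2 |v + w|^2 - <s, w> - L/2 |w|^2] that this comparison
   produces. *)
pose w := (L - mu)^-1 *: (mu *: v - s).
have /andP[lo _] := curvature_grad_bounds b (v + w).
have /andP[_ up] := curvature_grad_bounds a w.
have Ea : grad h a = grad h b + s by rewrite addrC subrK.
rewrite addrA -ab in lo; have {lo up} := le_trans lo up.
rewrite {}Ea /w; clearbody s; clear w.
rewrite -(ler_pM2l L0) -subr_ge0 -[in X in _ -> X]subr_ge0.
rewrite !dotvE (dotvC s v).
congr (0 <= _); rewrite /kappa; field.
by rewrite Ln0 Lmu.
Qed.

End curvature.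

(* With L scaled out: D = L (y - x), g = grad f1 y = grad f2 x, u = grad f1 x - g,
   p = grad f1 x' - g, q = grad f2 x' - g, so that grad f x' = p - q; E1, E2, E3
   are L times f1 x - f1 y, f1 y - f1 x' and f2 x' - f2 x. *)
Lemma boosted_step_inequality (R : realType) n (D u p q g : 'rV[R]_n)
    (kappa alpha E1 E2 E3 : R) (c := kappa / (2 * (1 - kappa))) :
  0 <= kappa < 1 -> 0 <= alpha <= Num.min 1 (2 * kappa) ->
  2^-1 * dotv u u + c * dotv (D + u) (D + u) <= E1 + dotv g D ->
  2^-1 * dotv u u + c * dotv (D + u) (D + u) <= - E1 - dotv (g + u) D ->
  2^-1 * dotv p p + c * dotv (alpha *: D - p) (alpha *: D - p)
    <= E2 + alpha * dotv (g + p) D ->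
  2^-1 * dotv p p + c * dotv (alpha *: D - p) (alpha *: D - p)
    <= - E2 - alpha * dotv g D ->
  2^-1 * dotv q q + c * dotv ((1 + alpha) *: D - q) ((1 + alpha) *: D - q)
    <= E3 - (1 + alpha) * dotv g D ->
  (2^-1 + kappa * alpha) * dotv u u + 2^-1 * dotv (p - q) (p - q)
    <= E1 + E2 + E3.
Proof.
rewrite le_min => /andP[k0 k1] /and3P[a0 a1 a2] I1 I2 I3 I4 I5.
have k1' : 0 < 1 - kappa by rewrite subr_gt0.
have c0 : 0 <= c by rewrite divr_ge0// mulr_ge0// ltW.
have [aE|an0] := eqVneq alpha 0.
  (* The case [x' = y]: [I3] and [I4] add up to [dotv p p <= 0]. *)
  have p0 : p = 0.
    apply: dotv_eq0; apply/eqP; rewrite eq_le dotv_ge0 andbT.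
    have := mulr_ge0 c0 (dotv_ge0 (alpha *: D - p)).
    move: I3 I4; rewrite aE; lra.
  have := mulr_ge0 c0 (dotv_ge0 (D + u)).
  have := mulr_ge0 c0 (dotv_ge0 ((1 + alpha) *: D - q)).
  have := mulr_ge0 c0 (dotv_ge0 (alpha *: D - p)).
  move: I1 I3 I5; rewrite p0 aE !dotvE !dotv0l !dotv0r; lra.
have ap : 0 < alpha by rewrite lt_neqAle eq_sym an0.
have kp : 0 < kappa by lra.
have kn0 : kappa != 0 by rewrite gt_eqF.
have k1n : 1 - kappa != 0 by rewrite gt_eqF.
(* These multipliers make the difference of both sides stationary at the
   extremal configuration u = - D, p = kappa alpha D, q = (1 + kappa alpha) D.
   As lam is singular at alpha = 0, that case is separate above. *)
pose nu := 2 * kappa * alpha.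
pose lam := (1 - alpha) / alpha.
have nu0 : 0 <= nu by rewrite !mulr_ge0.
have lam0 : 0 <= lam by rewrite divr_ge0// subr_ge0.
(* Like [u + D], both vectors vanish at the extremal configuration. *)
pose w := q - (1 + alpha) *: D + ((1 - kappa) / kappa) *: p.
pose r := p - (kappa * alpha) *: D.
have W : 0 <= (kappa * (1 + 2 * alpha + 2 * kappa * alpha) * dotv (u + D) (u + D)
    + kappa * dotv w w + (2 * kappa - alpha) / (alpha * kappa) * dotv r r)
    / (2 * (1 - kappa)).
  apply: divr_ge0; last by rewrite mulr_ge0// ltW.
  rewrite !addr_ge0// !mulr_ge0 ?dotv_ge0 ?invr_ge0 ?subr_ge0 ?mulr_ge0//.
  by rewrite !addr_ge0// !mulr_ge0.
(* The multipliers of [I1], [I2] and of [I3], [I4] differ by 1, so [E1] and [E2] keep coefficient 1;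
   adding [W] gives exactly the claimed difference. *)
move: I1 I2 I3 I4 I5; rewrite -subr_ge0 => /(mulr_ge0 (addr_ge0 ler01 nu0)) I1.
rewrite -subr_ge0 => /(mulr_ge0 nu0) I2.
rewrite -subr_ge0 => /(mulr_ge0 (addr_ge0 ler01 lam0)) I3.
rewrite -subr_ge0 => /(mulr_ge0 lam0) I4.
rewrite -subr_ge0 => I5; rewrite -subr_ge0.
have := addr_ge0 (addr_ge0 (addr_ge0 I1 I2) (addr_ge0 I3 I4)) (addr_ge0 I5 W).
rewrite /w /r /c /nu /lam !dotvE.
rewrite (dotvC D u) (dotvC D p) (dotvC D q) (dotvC q p).
by congr (0 <= _); field; rewrite kn0 an0 k1n.
Qed.

(** * Decrease along one step and the gap to the infimum *)

Section boosted_dca.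
Context (R : realType) (n : nat) (mu L : R) (f1 f2 : 'rV[R]_n -> R).
Context (mu0 : 0 <= mu) (muL : mu < L).
Context (hf1 : curvature_class mu L f1) (hf2 : curvature_class mu L f2).
Let kappa := mu / L.
Let f := f1 \- f2.

Lemma grad_sub x : grad f x = grad f1 x - grad f2 x.
Proof.
apply: (@grad_quadratic _ _ _ _ _ L) => v.
have /andP[] := curvature_grad_bounds hf1 x v.
have /andP[] := curvature_grad_bounds hf2 x v.
have := mulr_ge0 mu0 (dotv_ge0 v).
by rewrite /f/= !dotvE ler_norml => *; apply/andP; split; lra.
Qed.

Lemma bdca_step_decrease alpha x x' :
  0 <= alpha <= Num.min 1 (2 * kappa) -> bdca_step f1 f2 alpha x x' ->
  (2^-1 + kappa * alpha) * dotv (grad f x) (grad f x) +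
  2^-1 * dotv (grad f x') (grad f x') <= L * (f x - f x').
Proof.
move=> ha [g [y [/(subdifferential_grad hf2) gE ymin x'E]]].
(* Minimality of [y] for the linearized objective says that [g] is a subgradient of [f1] at [y]. *)
have {ymin}gy : g = grad f1 y.
  apply: (subdifferential_grad hf1) => z.
  by have := ymin z; rewrite !dotvE; lra.
have L0 : 0 < L by exact: le_lt_trans muL.
have k01 : 0 <= kappa < 1.
  by rewrite divr_ge0 ?(ltW L0)//= ltr_pdivrMr// mul1r.
pose d := y - x.
have x'x : x' = x + (1 + alpha) *: d.
  by rewrite x'E scalerDl scale1r addrA subrKC.
have xy : x = y + - d by rewrite opprB subrKC.
have yx : y = x + d by rewrite subrKC.
have yx' : y = x' + - (alpha *: d) by rewrite x'E addrK.
(* [f1] enters in both orders for [x], [y] and for [y], [x']; [f2] only with base point [x], where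
   its gradient is [g]. *)
have I1 := curvature_interpolation hf1 L0 muL xy.
have I2 := curvature_interpolation hf1 L0 muL yx.
have I3 := curvature_interpolation hf1 L0 muL yx'.
have I4 := curvature_interpolation hf1 L0 muL x'E.
have I5 := curvature_interpolation hf2 L0 muL x'x.
rewrite /= -/kappa -gE in I5; rewrite /= -/kappa -gy in I1 I2 I3 I4.
have split_x' : grad f x' = (grad f1 x' - g) - (grad f2 x' - g).
  by rewrite grad_sub opprB addrA subrK.
have -> : L * (f x - f x') = L * (f1 x - f1 y) + L * (f1 y - f1 x') +
    L * (f2 x' - f2 x) by rewrite /f/=; ring.
rewrite split_x' grad_sub -gE.
apply: (boosted_step_inequality (D := L *: d) (g := g) k01 ha);
  [move: I1 | move: I2 | move: I3 | move: I4 | move: I5];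
  clear; set c := kappa / _; clearbody c; rewrite !dotvE; lra.
Qed.

Lemma gap_ge_grad x : has_lbound (range f) ->
  dotv (grad f x) (grad f x) / (2 * (L - mu)) <= f x - inf (range f).
Proof.
move=> hb; set G := grad f x.
have Lmu : 0 < L - mu by rewrite subr_gt0.
(* The minimizer of [<G, v> + (L - mu)/2 |v|^2], which bounds [f (x + v) - f x] by the upper bound
   for [f1] and the lower one for [f2]. *)
pose v := - (L - mu)^-1 *: G.
have := @ge_inf _ _ hb (f (x + v)) (imageT f _).
have /andP[_] := curvature_grad_bounds hf1 x v.
have /andP[+ _] := curvature_grad_bounds hf2 x v.
have -> : grad f1 x = grad f2 x + G by rewrite /G grad_sub addrC subrK.
have -> : dotv G G / (2 * (L - mu)) = - dotv G v - (L - mu) / 2 * dotv v v.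
  by rewrite /v dotvZl !dotvZr; field; rewrite gt_eqF.
by rewrite dotvDl /f/=; lra.
Qed.

End boosted_dca.

Lemma min_upto_le (R : realType) m (F : nat -> R) k :
  (1 <= k <= m)%N -> min_upto m F <= F k.
Proof.
move=> km; apply: (bigmin_inf_seq _ k) => //.
by rewrite mem_index_iota ltnS.
Qed.

Unset Implicit Arguments.

Theorem theorem1 (R : realType) (n : nat) (mu L kappa : R)
  (f1 f2 f : 'rV[R]_n -> R) (N : nat) (alpha : R) (x : nat -> 'rV[R]_n)
  (hmu : 0 <= mu) (hmuL : mu < L) (hkappa : kappa = mu / L)
  (hf1 : curvature_class mu L f1) (hf2 : curvature_class mu L f2)
  (hf : f = f1 \- f2) (hfstar : has_lbound (range f))
  (hN : (1 <= N)%N)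
  (halpha : 0 <= alpha <= Num.min 1 (2 * kappa))
  (hx : bdca_iterates f1 f2 alpha N x) :
  [/\ forall k : nat, (1 <= k <= N.+1)%N ->
        grad f (x k) = grad f1 (x k) - grad f2 (x k),
      min_upto N.+1 (fun k => enorm (grad f (x k)) ^+ 2 / L) =
        min_upto N.+1 (fun k => enorm (grad f1 (x k) - grad f2 (x k)) ^+ 2 / L)
    & min_upto N.+1 (fun k => enorm (grad f1 (x k) - grad f2 (x k)) ^+ 2 / L)
        <= (f (x 1%N) - inf (range f)) /
           ((1 + kappa * alpha) * N%:R + 1 / (2 * (1 - kappa)))].
Proof.
subst f kappa; have L0 : 0 < L := le_lt_trans hmu hmuL.
have gradB := grad_sub hmu hf1 hf2.
split; first by move=> k _.
  by congr (min_upto _ _); apply/funext => k; rewrite gradB.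
set f := f1 \- f2; set kappa := mu / L in halpha *.
set F := fun k => _; set m := min_upto _ _.
have FE k : L * F k = dotv (grad f (x k)) (grad f (x k)).
  by rewrite /F -gradB enorm_sqr mulrC divfK// gt_eqF.
have mF k : (1 <= k <= N.+1)%N -> m <= F k := @min_upto_le _ _ F k.
clearbody m F; have /andP[a0 _] := halpha.
have k0 : 0 <= kappa by rewrite divr_ge0 ?(ltW L0).
have k1 : 0 < 1 - kappa by rewrite subr_gt0 ltr_pdivrMr// mul1r.
have ka0 : 0 <= kappa * alpha by rewrite mulr_ge0.
(* In each step [F j.+1] and [F j.+2] have weights [2^-1 + kappa * alpha] and [2^-1]; both values
   are at least [m], which gives [(1 + kappa * alpha) * m]. *)
have decrease j : (j <= N)%N ->
    (1 + kappa * alpha) * j%:R * m <= f (x 1%N) - f (x j.+1).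
  elim: j => [|j IH] jN; first by rewrite mulr0 mul0r subrr.
  have {}IH := IH (ltnW jN).
  have := bdca_step_decrease hmu hmuL hf1 hf2 halpha (hx j.+1 jN).
  rewrite -/f -/kappa -!FE => step.
  have {}step : (2^-1 + kappa * alpha) * F j.+1 + 2^-1 * F j.+2
      <= f (x j.+1) - f (x j.+2).
    by rewrite -(ler_pM2l L0); apply: etrans step; congr (_ <= _); ring.
  have m1 : m <= F j.+1 by apply: mF; exact: leqW.
  have m2 : m <= F j.+2 by apply: mF; exact: jN.
  have := ler_wpM2l ka0 m1.
  rewrite -natr1; lra.
have last_gap : m / (2 * (1 - kappa)) <= f (x N.+1) - inf (range f).
  apply: le_trans (gap_ge_grad hmu hmuL hf1 hf2 _ hfstar).
  rewrite -/f -FE.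
  have -> : L * F N.+1 / (2 * (L - mu)) = F N.+1 / (2 * (1 - kappa)).
    by rewrite /kappa; field; rewrite (gt_eqF L0) subr_eq0 (gt_eqF hmuL).
  by rewrite ler_pM2r ?invr_gt0 ?mulr_gt0// mF/=.
rewrite ler_pdivlMr; last first.
  by rewrite ltr_wpDl ?divr_gt0 ?mulr_gt0// mulr_ge0 ?addr_ge0.
(* Adding [last_gap] cancels [f (x N.+1)]. *)
have := decrease N (leqnn N); lra.
Qed.
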